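(* Let $a<b$ be real numbers and let $f\in C^2([a,b])$ be real-valued. Define $E^{CT}(f)$ by $$\int_a^b f(x)\,dx=\frac{b-a}{2}\left[f(a)+f(b)\right]+\frac{3(b-a)^2}{32}\left[f'(a)-f'(b)\right]+E^{CT}(f).$$ Then $$|E^{CT}(f)|\leq \frac{(b-a)^3\|f''\|_\infty}{32}.$$ Moreover (composite corrected trapezoidal rule), for every natural number $n\ge 1$, setting $x_i=a+(b-a)i/n$ for $0\leq i\leq n$ and defining $E^{CT}_n(f)$ by $$\int_a^b f(x)\,dx=\frac{b-a}{2n}\left[f(a)+2\sum_{i=1}^{n-1}f(x_i)+f(b)\right]+\frac{3(b-a)^2}{32n^2}\left[f'(a)-f'(b)\right]+E^{CT}_n(f),$$ one has $$|E^{CT}_n(f)|\leq\frac{(b-a)^3\|f''\|_\infty}{32n^2}.$$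
   Context: $C^2([a,b])$ denotes the functions on $[a,b]$ that are continuous together with their derivatives up to order $2$ on $[a,b]$ (one-sided derivatives at the endpoints). $\|g\|_\infty=\sup_{x\in[a,b]}|g(x)|$ is the uniform norm on $[a,b]$. An empty sum is $0$. *)

(* Defs.v *)
From Stdlib Require Import Reals.
From Coquelicot Require Import Coquelicot.
Open Scope R_scope.

Definition seg (a b : R) : R -> Prop := fun x => a <= x <= b.

(* f is in C^2([a,b]) with derivatives f' and f''.  The difference quotients in
   [D_in] range over points of [a,b] only, so derivatives and continuity are
   one-sided at a and b, and values outside [a,b] are irrelevant. *)
Record C2_on (a b : R) (f f' f'' : R -> R) : Prop := {
  C2_on_cont0 : forall x, seg a b x -> continue_in f (seg a b) x;
  C2_on_cont1 : forall x, seg a b x -> continue_in f' (seg a b) x;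
  C2_on_cont2 : forall x, seg a b x -> continue_in f'' (seg a b) x;
  C2_on_deriv1 : forall x, seg a b x -> D_in f f' (seg a b) x;
  C2_on_deriv2 : forall x, seg a b x -> D_in f' f'' (seg a b) x
}.

(* [real] sends an infinite supremum to 0; for g continuous on [a,b] with
   a <= b the supremum is finite. *)
Definition sup_norm (a b : R) (g : R -> R) : R :=
  real (Lub_Rbar (fun y => exists x, seg a b x /\ y = Rabs (g x))).

Definition node (a b : R) (n i : nat) : R := a + (b - a) * INR i / INR n.

(* Main.v *)
Require Import Defs.
From Stdlib Require Import Reals Lra Lia.
From Coquelicot Require Import Coquelicot.
Open Scope R_scope.

(** Write [h = q - p] and [c = (p + q) / 2] for a single panel [[p,q]]. Two
    integrations by parts express the error of the corrected trapezoidal rule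
    as a Peano kernel integral
      [E = int_p^q K(x) f''(x) dx],  [K(x) = (x - c)^2 / 2 - h^2 / 32]:
    the kernel of the plain trapezoidal rule is [(x - c)^2 / 2 - h^2 / 8], and
    the end correction shifts it by the constant [3 h^2 / 32]. Hence
    [|E| <= ||f''|| int |K|]. The kernel changes sign exactly at [c - h/4] and
    [c + h/4], and [int |K| = h^3 / 32].

    The estimate is carried out on primitives: [K f''] has the explicit
    primitive [remainder_primitive], since [K'' = 1], and [K] has the primitive
    [kernel_primitive]. On each of the three intervals where [K] has constant
    sign the increment of the first is at most [||f''||] times the absolute
    increment of the second, by the mean value theorem
    ([remainder_increment_le]). Adding the three gives
    [corrected_trapezoid_panel].

    For the composite rule the correction terms telescope, so the errors of the
    [n] panels of width [(b - a) / n] add up to at most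
    [n ((b - a) / n)^3 ||f''|| / 32] ([corrected_trapezoid_composite]).

    Composing [f], [f'] and [f''] with the retraction [clamp] of the line onto
    [[a,b]] turns one-sided continuity into continuity on the whole line and
    keeps the derivatives in the interior. This suits the mean value theorem,
    which asks for continuity on the closed interval and for derivatives on the
    open one. *)

(** * Extension of functions from a segment to the line *)

Definition clamp (a b x : R) : R := Rmax a (Rmin b x).

Lemma clamp_seg (a b x : R) : a <= b -> seg a b (clamp a b x).
Proof.
  intros hab; unfold clamp, seg; split; [apply Rmax_l|].
  apply Rmax_lub; [exact hab | apply Rmin_l].
Qed.

Lemma clamp_id (a b x : R) : seg a b x -> clamp a b x = x.
Proof.
  intros [h1 h2]; unfold clamp.
  rewrite Rmin_right by exact h2; apply Rmax_right; exact h1.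
Qed.

Lemma clamp_contracting (a b x y : R) :
  Rabs (clamp a b x - clamp a b y) <= Rabs (x - y).
Proof.
  unfold clamp, Rmax, Rmin.
  repeat (destruct (Rle_dec _ _)); unfold Rabs;
    repeat (destruct (Rcase_abs _)); lra.
Qed.

(** The distance to a clamped point does not increase, so a modulus of
    continuity for [g] on the segment serves for the extension as well. *)
Lemma continuous_clamp (a b : R) (g : R -> R) :
  a <= b -> (forall x, seg a b x -> continue_in g (seg a b) x) ->
  forall x, continuous (fun y => g (clamp a b y)) x.
Proof.
  intros hab hg x.
  apply continuity_pt_filterlim.
  intros eps heps.
  destruct (hg _ (clamp_seg a b x hab) eps heps) as [d [hd H]].
  exists d; split; [exact hd|].
  intros y [_ hy]; simpl in *; unfold Rdist in *.
  destruct (Req_dec (clamp a b x) (clamp a b y)) as [e|ne].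
  - rewrite e, Rminus_diag, Rabs_R0; exact heps.
  (* [continue_in] speaks of points distinct from the limit point only, which
     is why coinciding clamped points were set aside. *)
  - apply H; repeat split; try (apply clamp_seg; exact hab); try exact ne.
    eapply Rle_lt_trans; [apply clamp_contracting | exact hy].
Qed.

(** Restricted to interior points: a clamped function has in general a corner
    at the ends of the segment. *)
Lemma is_derive_clamp (a b : R) (g g' : R -> R) (x : R) :
  a < x < b -> D_in g g' (seg a b) x ->
  is_derive (fun y => g (clamp a b y)) x (g' (clamp a b x)).
Proof.
  intros [hax hxb] hD; apply is_derive_Reals; intros eps heps.
  destruct (hD eps heps) as [d [hd H]]; simpl in H; unfold Rdist in H.
  assert (hm : 0 < Rmin d (Rmin (x - a) (b - x)))
    by (repeat apply Rmin_pos; lra).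
  exists (mkposreal _ hm); intros h h0 hh; simpl in hh.
  pose proof (Rmin_l d (Rmin (x - a) (b - x))).
  pose proof (Rmin_r d (Rmin (x - a) (b - x))).
  pose proof (Rmin_l (x - a) (b - x)).
  pose proof (Rmin_r (x - a) (b - x)).
  assert (hs : seg a b (x + h))
    by (unfold seg; destruct (Rabs_def2 h (Rmin d (Rmin (x - a) (b - x))) hh); lra).
  rewrite !clamp_id by (exact hs || (unfold seg; lra)).
  replace h with (x + h - x) at 2 by ring.
  apply H; repeat split; try apply hs; try lra.
  replace (x + h - x) with h by ring; lra.
Qed.

(** Compactness makes the supremum in [sup_norm] finite, so that taking its
    real part loses nothing. *)
Lemma le_sup_norm (a b : R) (g : R -> R) :
  a <= b -> (forall x, seg a b x -> continue_in g (seg a b) x) ->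
  forall x, seg a b x -> Rabs (g x) <= sup_norm a b g.
Proof.
  intros hab hg x hx.
  assert (hc : forall y, a <= y <= b ->
             continuity_pt (fun z => Rabs (g (clamp a b z))) y).
  { intros y _; apply continuity_pt_filterlim.
    apply (continuous_comp (fun z => g (clamp a b z)) Rabs);
      [apply continuous_clamp; assumption | apply continuous_Rabs]. }
  destruct (continuity_ab_maj _ a b hab hc) as [m [hm _]].
  unfold sup_norm.
  destruct (Lub_Rbar_correct (fun y => exists x, seg a b x /\ y = Rabs (g x)))
    as [hub hlub].
  set (l := Lub_Rbar _) in *.
  assert (h1 : Rbar_le (Rabs (g x)) l) by (apply hub; exists x; auto).
  assert (h2 : Rbar_le l (Rabs (g (clamp a b m)))).
  { apply hlub; intros y [z [hz ->]]; simpl.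
    rewrite <- (clamp_id a b z hz) at 1; apply hm; exact hz. }
  destruct l; simpl in *; [exact h1 | contradiction | contradiction].
Qed.

(** * Increments of primitives *)

(** Both [L - W] and [L + W] are nondecreasing by the mean value theorem. The
    bound on [w] is asked for at the end points too, since the intermediate
    point that [MVT_gen] provides may be one of them. *)
Lemma Rabs_increment_le (W L w l : R -> R) (p q : R) :
  p <= q ->
  (forall x, continuous W x) -> (forall x, continuous L x) ->
  (forall x, p < x < q -> is_derive W x (w x)) ->
  (forall x, p < x < q -> is_derive L x (l x)) ->
  (forall x, p <= x <= q -> Rabs (w x) <= l x) ->
  Rabs (W q - W p) <= L q - L p.
Proof.
  intros hpq cW cL dW dL hwl.
  assert (mono : forall s : R, s = 1 \/ s = -1 ->
            s * (W q - W p) <= L q - L p).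
  { intros s hs.
    destruct (MVT_gen (fun x => L x - s * W x) p q (fun x => l x - s * w x))
      as [x [hx e]]; rewrite ?Rmin_left, ?Rmax_right in * by exact hpq.
    - intros x hx; apply @is_derive_minus; [apply dL, hx|].
      apply is_derive_scal, dW, hx.
    - intros x _; apply continuity_pt_filterlim; 
      apply (continuous_minus L (fun y => s * W y) x); [apply cL|].
      apply (continuous_scal_r s W), cW.
    - assert (hd : 0 <= l x - s * w x).
      { generalize (hwl x hx), (Rle_abs (w x)), (Rle_abs (- w x)).
        rewrite Rabs_Ropp; destruct hs as [-> | ->]; lra. }
      assert (0 <= (l x - s * w x) * (q - p)) by (apply Rmult_le_pos; lra).
      simpl in e; lra. }
  generalize (mono 1 (or_introl eq_refl)), (mono (-1) (or_intror eq_refl)).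
  intros; apply Rabs_le; lra.
Qed.

Lemma ex_RInt_of_continuous (f : R -> R) (p q : R) :
  (forall x, continuous f x) -> ex_RInt f p q.
Proof.
  intros cf; apply @ex_RInt_continuous; intros; apply cf.
Qed.

Lemma is_derive_RInt_upper (f : R -> R) (p x : R) :
  (forall x, continuous f x) -> is_derive (RInt f p) x (f x).
Proof.
  intros cf; apply (is_derive_RInt f _ p); [|apply cf].
  apply filter_forall; intros y; apply @RInt_correct.
  apply ex_RInt_of_continuous, cf.
Qed.

(** * The Peano kernel of the corrected trapezoidal rule *)

Definition kernel (c d x : R) : R := (x - c) ^ 2 / 2 - d.

Definition kernel_primitive (c d x : R) : R := (x - c) ^ 3 / 6 - d * (x - c).

(** A primitive of [kernel c d * f''] (with [f1 = f']), from two integrations by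
    parts: the kernel has second derivative 1, whence the integral of [f]. *)
Definition remainder_primitive (c d p : R) (f f1 : R -> R) (x : R) : R :=
  kernel c d x * f1 x - (x - c) * f x + RInt f p x.

(** Here [s] is the sign of the kernel on [[p,q]], so that
    [s * kernel_primitive] is a primitive of the absolute value of the kernel
    there. *)
Lemma remainder_increment_le (f f1 f2 : R -> R) (M c d r s p q : R) :
  p <= q ->
  (forall x, continuous f x) -> (forall x, continuous f1 x) ->
  (forall x, p < x < q -> is_derive f x (f1 x)) ->
  (forall x, p < x < q -> is_derive f1 x (f2 x)) ->
  (forall x, p <= x <= q -> Rabs (f2 x) <= M) ->
  (forall x, p <= x <= q -> Rabs (kernel c d x) = s * kernel c d x) ->
  Rabs (remainder_primitive c d r f f1 q - remainder_primitive c d r f f1 p)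
    <= s * M * (kernel_primitive c d q - kernel_primitive c d p).
Proof.
  intros hpq cf cf1 df df1 hM hs.
  rewrite Rmult_minus_distr_l.
  apply (Rabs_increment_le _ (fun x => s * M * kernel_primitive c d x)
           (fun x => kernel c d x * f2 x)
           (fun x => s * M * kernel c d x)); [exact hpq | | | | |].
  - intros x; unfold remainder_primitive; apply @continuous_plus.
    + apply @continuous_minus; apply @continuous_mult;
        try apply cf; try apply cf1;
        apply @ex_derive_continuous; unfold kernel; auto_derive; exact I.
    + apply @ex_derive_continuous; eexists; apply is_derive_RInt_upper, cf.
  - intros x; apply @ex_derive_continuous; unfold kernel_primitive.
    auto_derive; exact I.
  - intros x hx; unfold remainder_primitive.
    assert (dI := is_derive_RInt_upper f r x cf).
    assert (ef : ex_derive f x) by (eexists; apply df, hx).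
    assert (ef1 : ex_derive f1 x) by (eexists; apply df1, hx).
    assert (eI : ex_derive (RInt f r) x) by (eexists; apply dI).
    apply is_derive_unique in dI.
    pose proof (is_derive_unique _ _ _ (df x hx)) as uf.
    pose proof (is_derive_unique _ _ _ (df1 x hx)) as uf1.
    (* Kept abstract so that [auto_derive] does not differentiate under the
       integral sign. *)
    set (I0 := RInt f r) in *.
    unfold kernel; auto_derive; [repeat split; assumption|].
    change (Derive (fun x => f x) x) with (Derive f x).
    change (Derive (fun x => f1 x) x) with (Derive f1 x).
    change (Derive (fun x => I0 x) x) with (Derive I0 x).
    rewrite uf, uf1, dI; field.
  - intros x _; unfold kernel_primitive, kernel; auto_derive; [exact I | field].
  - intros x hx; rewrite Rabs_mult, (hs x hx).
    replace (s * M * kernel c d x) with (s * kernel c d x * M) by ring.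
    rewrite <- (hs x hx); apply Rmult_le_compat_l; [apply Rabs_pos | auto].
Qed.

(** * Error bounds *)

(** The shift [h^2 / 32] makes the kernel equal to [3 h^2 / 32] at both ends,
    which is the coefficient of the correction [f1 p - f1 q]; and
    [x - c] equals [- h / 2] at [p] and [h / 2] at [q], which gives the trapezoidal term. *)
Lemma corrected_trapezoid_panel (f f1 f2 : R -> R) (M p q : R) :
  p <= q ->
  (forall x, continuous f x) -> (forall x, continuous f1 x) ->
  (forall x, p < x < q -> is_derive f x (f1 x)) ->
  (forall x, p < x < q -> is_derive f1 x (f2 x)) ->
  (forall x, p <= x <= q -> Rabs (f2 x) <= M) ->
  Rabs (RInt f p q - ((q - p) / 2 * (f p + f q)
                      + 3 * (q - p) ^ 2 / 32 * (f1 p - f1 q)))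
    <= (q - p) ^ 3 * M / 32.
Proof.
  intros hpq cf cf1 df df1 hM.
  set (c := (p + q) / 2); set (h := q - p).
  set (d := h ^ 2 / 32).
  set (W := remainder_primitive c d p f f1).
  (* [u] and [v] are the two zeros of the kernel. *)
  set (u := c - h / 4); set (v := c + h / 4).
  assert (B1 : Rabs (W u - W p)
            <= 1 * M * (kernel_primitive c d u - kernel_primitive c d p)).
  { apply (remainder_increment_le f f1 f2); try assumption;
      intros; try (first [apply df | apply df1 | apply hM]); unfold u, c, h in *;
      try lra.
    rewrite Rmult_1_l; apply Rabs_pos_eq; unfold kernel, d, h, c; nra. }
  assert (B2 : Rabs (W v - W u)
            <= -1 * M * (kernel_primitive c d v - kernel_primitive c d u)).
  { apply (remainder_increment_le f f1 f2); try assumption;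
      intros; try (first [apply df | apply df1 | apply hM]); unfold u, v, c, h in *;
      try lra.
    replace (-1 * kernel ((p + q) / 2) d x) with (- kernel ((p + q) / 2) d x)
      by ring.
    apply Rabs_left1; unfold kernel, d, h, c; nra. }
  assert (B3 : Rabs (W q - W v)
            <= 1 * M * (kernel_primitive c d q - kernel_primitive c d v)).
  { apply (remainder_increment_le f f1 f2); try assumption;
      intros; try (first [apply df | apply df1 | apply hM]); unfold v, c, h in *;
      try lra.
    rewrite Rmult_1_l; apply Rabs_pos_eq; unfold kernel, d, h, c; nra. }
  match goal with |- Rabs ?e <= ?r =>
    replace e with ((W q - W v) + (W v - W u) + (W u - W p));
    [replace r with
       (1 * M * (kernel_primitive c d q - kernel_primitive c d v)
        + -1 * M * (kernel_primitive c d v - kernel_primitive c d u)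
        + 1 * M * (kernel_primitive c d u - kernel_primitive c d p))|]
  end.
  - eapply Rle_trans; [apply Rabs_triang|]; apply Rplus_le_compat; [|exact B1].
    eapply Rle_trans; [apply Rabs_triang|]; apply Rplus_le_compat; assumption.
  - unfold kernel_primitive, u, v, d, c, h; field.
  - unfold W, remainder_primitive; rewrite RInt_point.
    unfold kernel, d, c, h, zero; simpl; field.
Qed.

(** Adjoining a panel doubles the weight of the former end node, and the
    corrections telescope. Counting the panels by [S k] makes the inner nodes
    exactly those of index 1 to [k], with no truncated subtraction. *)
Lemma corrected_trapezoid_composite (f f1 f2 : R -> R) (M a h : R) (k : nat) :
  0 <= h ->
  (forall x, continuous f x) -> (forall x, continuous f1 x) ->
  (forall x, a < x < a + h * INR (S k) -> is_derive f x (f1 x)) ->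
  (forall x, a < x < a + h * INR (S k) -> is_derive f1 x (f2 x)) ->
  (forall x, a <= x <= a + h * INR (S k) -> Rabs (f2 x) <= M) ->
  Rabs (RInt f a (a + h * INR (S k))
        - (h / 2 * (f a + 2 * sum_n_m (fun i : nat => f (a + h * INR i)) 1 k
                    + f (a + h * INR (S k)))
           + 3 * h ^ 2 / 32 * (f1 a - f1 (a + h * INR (S k)))))
    <= INR (S k) * (h ^ 3 * M / 32).
Proof.
  intros hh cf cf1; induction k as [|k IH]; intros df df1 hM.
  - rewrite sum_n_m_zero by lia.
    simpl INR in *; rewrite Rmult_1_r in *.
    pose proof (corrected_trapezoid_panel f f1 f2 M a (a + h)) as P.
    replace (a + h - a) with h in P by ring.
    unfold zero; simpl; rewrite Rmult_0_r, Rplus_0_r, Rmult_1_l.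
    apply P; try assumption; lra.
  - set (y := a + h * INR (S k)) in *; set (z := a + h * INR (S (S k))) in *.
    assert (ezy : z - y = h) by (unfold y, z; rewrite (S_INR (S k)); ring).
    assert (hy : a <= y)
      by (unfold y; generalize (pos_INR (S k)); nra).
    assert (IH' := IH ltac:(intros; apply df; lra)
                      ltac:(intros; apply df1; lra)
                      ltac:(intros; apply hM; lra)).
    assert (P : Rabs (RInt f y z - ((z - y) / 2 * (f y + f z)
                      + 3 * (z - y) ^ 2 / 32 * (f1 y - f1 z)))
                <= (z - y) ^ 3 * M / 32).
    { apply (corrected_trapezoid_panel f f1 f2); try assumption; intros;
        first [apply df | apply df1 | apply hM | idtac]; lra. }
    rewrite ezy in P.
    rewrite sum_n_Sm by lia.
    rewrite <- (RInt_Chasles f a y z)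
      by (apply ex_RInt_of_continuous, cf).
    fold y; unfold plus; simpl plus.
    rewrite (S_INR (S k)), Rmult_plus_distr_r, Rmult_1_l.
    eapply Rle_trans; [|apply Rplus_le_compat; [exact IH' | exact P]].
    eapply Rle_trans; [|apply Rabs_triang].
    right; f_equal; simpl; ring.
Qed.

Theorem theorem3p2 (a b : R) (f f' f'' : R -> R)
  (hab : a < b) (hf : C2_on a b f f' f'') :
  (forall E : R,
     RInt f a b =
       (b - a) / 2 * (f a + f b)
       + 3 * (b - a) ^ 2 / 32 * (f' a - f' b) + E ->
     Rabs E <= (b - a) ^ 3 * sup_norm a b f'' / 32)
  /\
  (forall (n : nat) (E : R),
     (1 <= n)%nat ->
     RInt f a b =
       (b - a) / (2 * INR n)
         * (f a + 2 * sum_n_m (fun i : nat => f (node a b n i)) 1 (n - 1) + f b)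
       + 3 * (b - a) ^ 2 / (32 * INR n ^ 2) * (f' a - f' b) + E ->
     Rabs E <= (b - a) ^ 3 * sup_norm a b f'' / (32 * INR n ^ 2)).
Proof.
  destruct hf as [c0 c1 c2 d1 d2].
  assert (hle : a <= b) by lra.
  set (F := fun x => f (clamp a b x)).
  set (F1 := fun x => f' (clamp a b x)).
  set (F2 := fun x => f'' (clamp a b x)).
  set (M := sup_norm a b f'').
  assert (eF : forall x, seg a b x -> F x = f x)
    by (intros x hx; unfold F; rewrite clamp_id by exact hx; reflexivity).
  assert (eF1 : forall x, seg a b x -> F1 x = f' x)
    by (intros x hx; unfold F1; rewrite clamp_id by exact hx; reflexivity).
  assert (ha : seg a b a) by (unfold seg; lra).
  assert (hb : seg a b b) by (unfold seg; lra).
  assert (eI : RInt f a b = RInt F a b).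
  { apply RInt_ext; rewrite Rmin_left, Rmax_right by lra.
    intros x hx; symmetry; apply eF; unfold seg; lra. }
  assert (composite : forall (n : nat) (E : R),
     (1 <= n)%nat ->
     RInt f a b =
       (b - a) / (2 * INR n)
         * (f a + 2 * sum_n_m (fun i : nat => f (node a b n i)) 1 (n - 1) + f b)
       + 3 * (b - a) ^ 2 / (32 * INR n ^ 2) * (f' a - f' b) + E ->
     Rabs E <= (b - a) ^ 3 * M / (32 * INR n ^ 2)).
  { intros [|k] E hn hE; [lia|].
    replace (S k - 1)%nat with k in hE by lia.
    assert (hn0 : 0 < INR (S k)) by (apply lt_0_INR; lia).
    set (h := (b - a) / INR (S k)).
    assert (eb : a + h * INR (S k) = b) by (unfold h; field; lra).
    assert (hh : 0 < h) by (apply Rdiv_lt_0_compat; lra).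
    assert (P : Rabs (RInt F a (a + h * INR (S k))
        - (h / 2 * (F a + 2 * sum_n_m (fun i : nat => F (a + h * INR i)) 1 k
                    + F (a + h * INR (S k)))
           + 3 * h ^ 2 / 32 * (F1 a - F1 (a + h * INR (S k)))))
        <= INR (S k) * (h ^ 3 * M / 32)).
    { apply (corrected_trapezoid_composite F F1 F2).
      - lra.
      - apply continuous_clamp; assumption.
      - apply continuous_clamp; assumption.
      - rewrite eb; intros x hx; apply is_derive_clamp; [exact hx|].
        apply d1; unfold seg; lra.
      - rewrite eb; intros x hx; apply is_derive_clamp; [exact hx|].
        apply d2; unfold seg; lra.
      - intros x _; apply (le_sup_norm a b f''); try assumption.
        apply clamp_seg, hle. }
    rewrite eb, <- eI, (eF a ha), (eF b hb), (eF1 a ha), (eF1 b hb), hE in P.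
    rewrite (sum_n_m_ext_loc (fun i => F (a + h * INR i))
               (fun i => f (node a b (S k) i))) in P.
    - replace ((b - a) ^ 3 * M / (32 * INR (S k) ^ 2))
        with (INR (S k) * (h ^ 3 * M / 32)) by (unfold h; field; lra).
      eapply Rle_trans; [right|exact P]; f_equal; unfold h; field; lra.
    - intros i hi; unfold node.
      replace (a + (b - a) * INR i / INR (S k)) with (a + h * INR i)
        by (unfold h; field; lra).
      apply eF; unfold seg.
      assert (INR i <= INR (S k)) by (apply le_INR; lia).
      generalize (pos_INR i); rewrite <- eb; nra. }
  (* The simple rule is the composite rule with one panel. *)
  split; [|exact composite].
  intros E hE.
  generalize (composite 1%nat E (le_n 1)); simpl Nat.sub; simpl INR.
  rewrite sum_n_m_zero by lia; unfold zero; simpl zero; intros P.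
  replace ((b - a) ^ 3 * M / 32) with ((b - a) ^ 3 * M / (32 * 1 ^ 2)) by field.
  apply P; rewrite hE; simpl; field.
Qed.
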